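(* Let $g=\sum_{n\ge2}d_n\psi_n$ be the smoothed annuli symbol described in the context. Then for every fixed $a\in\mathbb{C}$, \[ \int_{\mathbb{C}} e^{-|z-a|^2}|g(z)|^2\,dA(z)<\infty, \] but \[ \sup_{a\in\mathbb{C}}\int_{\mathbb{C}} e^{-|z-a|^2}|g(z)|^2\,dA(z)=\infty, \] and the divergence occurs along a sequence escaping to infinity: there is a sequence $(b_n)$ in $\mathbb{C}$ with $|b_n|\to\infty$ and $\int_{\mathbb{C}} e^{-|z-b_n|^2}|g(z)|^2\,dA(z)\to\infty$.
   Context: $dA$ is planar Lebesgue measure on $\mathbb{C}$. For $n\ge2$ let $a_n=\sqrt n$, $\rho_n=n^{-9/2}$, $d_n=n^{5/2}\log n$, and $A_n=\{z\in\mathbb{C}:\ ||z|-a_n|\le\rho_n\}$; these annuli are pairwise disjoint, and $|A_n|$ denotes the area of $A_n$. For each $n\ge2$ let $\psi_n\in C_c^\infty(\mathbb{C})$ be a radial function with $\operatorname{supp}\psi_n\subset A_n$, $0\le\psi_n\le1$, and $\int_{\mathbb{C}}\psi_n\,dA\ge c_1|A_n|$, where $c_1>0$ is independent of $n$. The smoothed annuli symbol is $g=\sum_{n\ge2}d_n\psi_n$. *)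

(* Defs.v *)
From HB Require Import structures.
From mathcomp Require Import all_boot all_order all_algebra.
From mathcomp Require Import complex.
From mathcomp Require Import all_classical all_reals all_analysis.

Set Implicit Arguments.
Unset Strict Implicit.
Unset Printing Implicit Defensive.

Import Order.TTheory GRing.Theory Num.Theory.
Import numFieldNormedType.Exports.

Local Open Scope classical_set_scope.
Local Open Scope ring_scope.

(* The complex plane is R[i]; its topology, smooth structure and Lebesgue
   measure are those of R * R, carried over by (x, y) |-> x + iy. *)
Definition cplx (R : realType) (p : R * R) : R[i] := Complex p.1 p.2.

(* The R-valued modulus: the generic norm `|z| on R[i] takes values in R[i]. *)
Definition cabs (R : realType) (z : R[i]) : R := ComplexField.Normc.normc z.

Definition planar_lebesgue (R : realType) :
    {measure set (measurableTypeR R * measurableTypeR R) -> \bar R} :=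
  (@lebesgue_measure R \x @lebesgue_measure R)%E.

Definition area (R : realType) (A : set R[i]) : \bar R :=
  planar_lebesgue R (@cplx R @^-1` A).

Definition planar_integral (R : realType) (f : R[i] -> \bar R) : \bar R :=
  (\int[planar_lebesgue R]_p f (cplx p))%E.

Definition axis (R : realType) (b : bool) : R * R :=
  if b then (0, 1) else (1, 0).

Definition partials (R : realType) (f : R * R -> R) (s : seq bool)
  : R * R -> R :=
  foldr (fun b h p => 'D_(axis R b) h p) f s.

(* 'D is total, so the existence of each iterated partial derivative has to be
   required separately. *)
Definition smooth (R : realType) (f : R * R -> R) : Prop :=
  forall s : seq bool,
    continuous (partials f s) /\
    forall b p, derivable (partials f s) p (axis R b).

Definition tsupport (R : realType) (f : R[i] -> R) : set (R * R) :=
  closure [set p | f (cplx p) != 0].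

Definition Cc_infty (R : realType) (f : R[i] -> R) : Prop :=
  smooth (f \o @cplx R) /\ compact (tsupport f).

Definition radial (R : realType) (f : R[i] -> R) : Prop :=
  forall z w, cabs z = cabs w -> f z = f w.

Definition a_ (R : realType) (n : nat) : R := Num.sqrt n%:R.
Definition rho_ (R : realType) (n : nat) : R := n%:R `^ (- (9 / 2)).
Definition d_ (R : realType) (n : nat) : R := n%:R `^ (5 / 2) * ln n%:R.

Definition annulus (R : realType) (n : nat) : set R[i] :=
  [set z | `|cabs z - a_ R n| <= rho_ R n].

(* Pointwise sum in R; at most one term is nonzero at each point once the
   supports lie in the disjoint annuli. *)
Definition annuli_symbol (R : realType) (psi : nat -> R[i] -> R) (z : R[i])
  : R :=
  limn (fun N => \sum_(2 <= n < N) d_ R n * psi n z).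

Definition gauss_average (R : realType) (g : R[i] -> R) (a : R[i]) : \bar R :=
  planar_integral
    (fun z => (expR (- cabs (z - a) ^+ 2) * `|g z| ^+ 2)%:E).

(* Main.v *)
Require Import Defs.
From HB Require Import structures.
From mathcomp Require Import all_boot all_order all_algebra.
From mathcomp Require Import complex.
From mathcomp Require Import all_classical all_reals all_analysis.
From mathcomp Require Import measurable_realfun.
From mathcomp Require Import lra ring.

Set Implicit Arguments.
Unset Strict Implicit.
Unset Printing Implicit Defensive.

Import Order.TTheory GRing.Theory Num.Theory.
Import numFieldNormedType.Exports.

Local Open Scope classical_set_scope.
Local Open Scope ring_scope.

(** The growth of g is polynomial, so any single Gaussian weight tames it; but the
   mass of |g|^2 at bounded distance from suitable points near A_n grows with n.

   Finiteness.  A point z of A_n satisfies n <= (|z| + 1)^2, so the series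
   defining g(z) is a finite sum of at most about |z|^2 terms, each bounded by
   d_n <= n^4.  Hence g grows polynomially, |g(z)|^2 <= C exp(|z|^2 / 4)
   ([annuli_symbol_growth]), and since |z|^2 / 2 <= |z - a|^2 + |a|^2 the
   integrand is dominated by a multiple of exp(-|z|^2 / 4)
   ([gauss_average_lty]).

   Divergence.  Put h = d_n psi_n <= g.  The mass condition and the pointwise
   inequality c f <= f^2 + c^2 / 4 give a lower bound for the integral of h^2 by
   (3/4) c1^2 d_n^2 |A_n| ([integral_sqr_ge]), where |A_n| >= a_n rho_n = n^-4
   by slicing along vertical lines ([area_annulus_ge]); this is of order
   n (log n)^2.  The annulus A_n is covered by at most 49 n discs of radius
   sqrt 2 centred at integer points of modulus at least a_n - 3, so by
   pigeonhole one of these points, b_n, has a Gaussian average of order at least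
   (log n)^2 ([exists_heavy_center]).  No circle geometry is needed: the exponents
   leave enough room for the crude count of all grid points of a square of side
   comparable to a_n, and the pigeonhole replaces any use of rotations. *)

(** Points of the plane as pairs, with the product Borel sigma-algebra. *)
Local Notation plane R := (measurableTypeR R * measurableTypeR R)%type.

(** * Modulus and measurability *)

Lemma cabs_ge0 (R : realType) (z : R[i]) : 0 <= cabs z.
Proof. by case: z => x y; rewrite /cabs /= sqrtr_ge0. Qed.

Lemma le_cabsD (R : realType) (z w : R[i]) : cabs (z + w) <= cabs z + cabs w.
Proof. exact: (@le_normcD R). Qed.

Lemma cabs_sqr (R : realType) (z : R[i]) :
  cabs z ^+ 2 = complex.Re z ^+ 2 + complex.Im z ^+ 2.
Proof. by case: z => x y; rewrite /cabs /= sqr_sqrtr ?addr_ge0 ?sqr_ge0. Qed.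

Lemma measurable_cabsB (R : realType) (a : R[i]) :
  measurable_fun [set: plane R]
    (fun p : plane R => cabs (cplx p - a)).
Proof.
case: a => u v; rewrite /cabs/=.
apply: measurableT_comp => /=.
  by apply: continuous_measurable_fun; exact: sqrt_continuous.
apply: measurable_funD; apply: measurable_funX; apply: measurable_funB => //.
Qed.

Lemma measurable_cabs (R : realType) :
  measurable_fun [set: plane R]
    (fun p : plane R => cabs (cplx p)).
Proof. by have := measurable_cabsB (R := R) 0; under eq_fun do rewrite subr0. Qed.

(** A radial function is a continuous function of the modulus, which spares any
   comparison of the Borel and product sigma-algebras of the plane. *)
Lemma measurable_radial (R : realType) (f : R[i] -> R) :
  continuous (f \o @cplx R) -> radial f ->
  measurable_fun [set: plane R]
    (f \o @cplx R : plane R -> R).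
Proof.
move=> cf rf.
pose h (r : R) : R := f (cplx (r, 0)).
have -> : f \o @cplx R = h \o (fun p => cabs (cplx p)).
  apply/funext => p; apply: rf; rewrite {2}/cabs /= expr0n /= addr0 sqrtr_sqr.
  by rewrite ger0_norm// cabs_ge0.
apply: measurableT_comp; last exact: measurable_cabs.
apply: continuous_measurable_fun => r.
apply: (@continuous2_cvg _ R R R _ _ (fun x => x) (fun=> 0)
  (fun u v => f (cplx (u, v))) r 0).
- have -> : (fun z : R * R => f (cplx (z.1, z.2))) = f \o @cplx R.
    by apply/funext => -[].
  exact: cf.
- exact: cvg_id.
- exact: cvg_cst.
Qed.

Lemma measurable_annulus (R : realType) n :
  measurable (@cplx R @^-1` @annulus R n
    : set (plane R)).
Proof.
have mB : measurable_fun [set: plane R]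
    (fun p => `|cabs (cplx p) - a_ R n|).
  apply: measurableT_comp => //; apply: measurable_funB => //.
  exact: measurable_cabs.
have /(_ measurableT _ (measurable_itv `]-oo, rho_ R n])) := mB.
by rewrite setTI; congr measurable; apply/seteqP; split => p /=; rewrite in_itv.
Qed.

(** * Integrability of the Gaussian *)

Lemma gauss_line_lty (R : realType) :
  (\int[@lebesgue_measure R]_x (expR (- (x ^+ 2 / 4)))%:E < +oo)%E.
Proof.
(* exp(-x^2 / 4) is, up to a constant, the normal density of variance 2 *)
pose s : R := Num.sqrt 2.
have s0 : s != 0 by rewrite gt_eqF// sqrtr_gt0.
have := integrable_normal_pdf 0 s.
move=> /(integrableZl measurableT (normal_peak s)^-1) /integrableP[_].
apply: le_lt_trans; rewrite le_eqVlt; apply/orP; left; apply/eqP.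
apply: eq_integral => x _ /=; rewrite normal_pdfE// mulrA mulVf; last first.
  by rewrite gt_eqF// normal_peak_gt0.
rewrite mul1r /normal_fun ger0_norm ?expR_ge0// subr0 sqr_sqrtr//.
by congr (expR _)%:E; lra.
Qed.

Lemma gauss_plane_lty (R : realType) :
  (planar_integral (fun z : R[i] => (expR (- (cabs z ^+ 2 / 4)))%:E) < +oo)%E.
Proof.
rewrite /planar_integral /planar_lebesgue fubini_tonelli1; last 2 first.
- apply/measurable_EFinP; apply: measurableT_comp => //.
  apply: measurableT_comp => //; apply: measurable_funM => //.
  by apply: measurable_funX; exact: measurable_cabs.
- by move=> p; rewrite lee_fin expR_ge0.
pose G := (\int[@lebesgue_measure R]_x (expR (- (x ^+ 2 / 4)))%:E)%E.
have mG : measurable_fun [set: measurableTypeR R]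
    (fun x : R => (expR (- (x ^+ 2 / 4)))%:E).
  apply/measurable_EFinP; apply: measurableT_comp => //.
  apply: measurableT_comp => //; apply: measurable_funM => //.
rewrite [ltLHS](_ : _ =
    (\int[@lebesgue_measure R]_x ((expR (- (x ^+ 2 / 4)))%:E * G))%E); last first.
  apply: eq_integral => x _; rewrite /fubini_F -ge0_integralZl//.
  apply: eq_integral => y _; rewrite -EFinM -expRD cabs_sqr /=.
  by congr (expR _)%:E; lra.
have G0 : (0 <= G)%E by apply: integral_ge0 => x _; rewrite lee_fin expR_ge0.
rewrite ge0_integralZr//.
by apply: lte_mul_pinfty => //; rewrite ?ge0_fin_numE// gauss_line_lty.
Qed.

(** * Pointwise bounds on the symbol *)

Lemma rho_le1 (R : realType) n : (0 < n)%N -> rho_ R n <= 1.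
Proof.
move=> n0; rewrite /rho_ -[leRHS](powRr0 (n%:R : R)).
by apply: ler_powR; rewrite ?ler1n//; lra.
Qed.

Lemma rho_gt0 (R : realType) n : (0 < n)%N -> 0 < rho_ R n.
Proof. by move=> n0; rewrite /rho_ powR_gt0// ltr0n. Qed.

Lemma annulus_index_le (R : realType) n (z : R[i]) : (0 < n)%N ->
  annulus n z -> n%:R <= (cabs z + 1) ^+ 2.
Proof.
move=> n0; rewrite /annulus/= ler_norml => /andP[h _].
have h1 := rho_le1 R n0.
have h2 : a_ R n <= cabs z + 1 by lra.
rewrite -[leLHS]sqr_sqrtr ?ler0n// lerXn2r// nnegrE ?sqrtr_ge0//.
by rewrite addr_ge0// cabs_ge0.
Qed.

Lemma d_ge0 (R : realType) n : 0 <= d_ R n.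
Proof.
case: n => [|n]; first by rewrite /d_ ln0// mulr0.
by rewrite mulr_ge0 ?powR_ge0// ln_ge0// ler1n.
Qed.

Lemma d_le (R : realType) n : (0 < n)%N -> d_ R n <= n%:R ^+ 4.
Proof.
move=> n0; rewrite (exprSr _ 3) /d_; apply: ler_pM; rewrite ?powR_ge0 ?ln_ge0 ?ler1n//.
- by rewrite -powR_mulrn ?ler0n//; apply: ler_powR; rewrite ?ler1n//; lra.
- by apply/ltW/ln_sublinear; rewrite ltr0n.
Qed.

Lemma le_expr_expR (R : realType) (u : R) k :
  0 <= u -> u ^+ k.+1 <= 8 ^+ k.+1 * (k.+1)`!%:R * expR (u / 8).
Proof.
move=> u0; have h := @expR_ge1Dxn R (u / 8) k.
have f0 : 0 < (k.+1)`!%:R :> R by rewrite ltr0n fact_gt0.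
have {h} h : (u / 8) ^+ k.+1 / (k.+1)`!%:R <= expR (u / 8).
  by apply: le_trans (h _); [rewrite lerDr ler01|rewrite divr_ge0].
rewrite -{1}(@divfK _ 8 _ u)// mulrC exprMn -mulrA ler_wpM2l ?exprn_ge0//.
by rewrite [leRHS]mulrC -ler_pdivrMr.
Qed.

(** The partial sums of g(z) are constant from the first N > (|z| + 1)^2 on. *)
Lemma annuli_partial_sum (R : realType) (psi : nat -> R[i] -> R) (z : R[i]) N M :
  (forall n, (2 <= n)%N -> psi n z != 0 -> annulus n z) ->
  (cabs z + 1) ^+ 2 < N%:R -> (N <= M)%N ->
  \sum_(2 <= n < M) d_ R n * psi n z = \sum_(2 <= n < N) d_ R n * psi n z.
Proof.
move=> supp zN NM.
have N2 : (2 <= N)%N.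
  rewrite -(ltr_nat R); apply: le_lt_trans zN.
  by have := cabs_ge0 z; rewrite expr2; nra.
rewrite (big_cat_nat N2 NM)/= [X in _ + X]big_nat_cond [X in _ + X]big1 ?addr0// => n.
rewrite andbT => /andP[Nn _].
have [->|/supp] := eqVneq (psi n z) 0; first by rewrite mulr0.
move=> /(_ (leq_trans N2 Nn)).
move=> /(annulus_index_le (leq_trans (ltnW N2) Nn)) zn.
by have := le_lt_trans zn zN; rewrite ltr_nat ltnNge Nn.
Qed.

Lemma annuli_symbolE (R : realType) (psi : nat -> R[i] -> R) (z : R[i]) N :
  (forall n, (2 <= n)%N -> psi n z != 0 -> annulus n z) ->
  (cabs z + 1) ^+ 2 < N%:R ->
  annuli_symbol psi z = \sum_(2 <= n < N) d_ R n * psi n z.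
Proof.
move=> supp zN; apply: cvg_lim => //.
apply: cvg_near_cst; near=> M; apply: annuli_partial_sum => //.
by near: M; exact: nbhs_infty_ge.
Unshelve. all: by end_near. Qed.

Lemma annuli_symbol_cvg (R : realType) (psi : nat -> R[i] -> R) (z : R[i]) :
  (forall n, (2 <= n)%N -> psi n z != 0 -> annulus n z) ->
  \sum_(2 <= n < N) d_ R n * psi n z @[N --> \oo] --> annuli_symbol psi z.
Proof.
move=> supp.
have zN : (cabs z + 1) ^+ 2 < (Num.truncn ((cabs z + 1) ^+ 2)).+1%:R.
  by rewrite truncnS_gt.
rewrite (annuli_symbolE supp zN); apply: cvg_near_cst.
near=> M; apply: annuli_partial_sum => //.
by near: M; exact: nbhs_infty_ge.
Unshelve. all: by end_near. Qed.

Lemma annuli_symbol_ge (R : realType) (psi : nat -> R[i] -> R) (z : R[i]) n :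
  (forall n, (2 <= n)%N -> psi n z != 0 -> annulus n z) ->
  (forall n, (2 <= n)%N -> 0 <= psi n z <= 1) -> (2 <= n)%N ->
  d_ R n * psi n z <= annuli_symbol psi z.
Proof.
move=> supp psi01 n2.
pose N := maxn n.+1 (Num.truncn ((cabs z + 1) ^+ 2)).+1.
have nN : (n < N)%N by rewrite leq_max leqnn.
rewrite (@annuli_symbolE _ _ _ N)//; last first.
  by apply: (lt_le_trans (truncnS_gt _)); rewrite ler_nat leq_max leqnn orbT.
have mN : n \in index_iota 2 N by rewrite mem_index_iota n2.
rewrite (bigD1_seq n)//= ?iota_uniq// lerDl big_seq_cond sumr_ge0// => m.
rewrite mem_index_iota => /andP[/andP[m2 _] _].
by rewrite mulr_ge0 ?d_ge0//; case/andP: (psi01 _ m2).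
Qed.

(** With N of order |z|^2 one has g(z) <= N^5, hence |g(z)|^2 <= N^10, a power of
   u = 2 |z|^2 + 3 dominated by exp(u / 8). *)
Lemma annuli_symbol_growth (R : realType) : exists C : R, 0 <= C /\
  forall (psi : nat -> R[i] -> R) (z : R[i]),
  (forall n, (2 <= n)%N -> psi n z != 0 -> annulus n z) ->
  (forall n, (2 <= n)%N -> 0 <= psi n z <= 1) ->
  `|annuli_symbol psi z| ^+ 2 <= C * expR (cabs z ^+ 2 / 4).
Proof.
(* k = 9 is kept abstract so that the factorial of 10 is never computed *)
have [k k10] : exists k, k = 9%N by exists 9%N.
exists (8 ^+ k.+1 * (k.+1)`!%:R * expR (3 / 8)); split.
  by rewrite !mulr_ge0 ?exprn_ge0 ?expR_ge0.
move=> psi z supp psi01.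
pose N := (Num.truncn ((cabs z + 1) ^+ 2)).+1.
have zN : (cabs z + 1) ^+ 2 < N%:R by rewrite truncnS_gt.
have z0 := cabs_ge0 z.
have Nz : N%:R <= 2 * cabs z ^+ 2 + 3.
  rewrite /N -natr1; have : (Num.truncn ((cabs z + 1) ^+ 2))%:R <= (cabs z + 1) ^+ 2.
    by rewrite truncn_le// sqr_ge0.
  by have := sqr_ge0 (cabs z - 1); lra.
have g0 : 0 <= annuli_symbol psi z.
  rewrite (annuli_symbolE supp zN) big_nat_cond sumr_ge0// => m.
  rewrite andbT => /andP[m2 _]; rewrite mulr_ge0 ?d_ge0//.
  by case/andP: (psi01 _ m2).
have gN : annuli_symbol psi z <= N%:R ^+ 5.
  rewrite (annuli_symbolE supp zN) (@le_trans _ _ (\sum_(2 <= n < N) N%:R ^+ 4))//.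
    apply: ler_sum_nat => m /andP[m2 mN].
    rewrite -[leRHS]mulr1; apply: ler_pM; rewrite ?d_ge0//.
    - by case/andP: (psi01 _ m2).
    - apply: le_trans (d_le _ _) _; first exact: ltnW.
      by rewrite lerXn2r ?nnegrE ?ler0n// ler_nat ltnW.
    - by case/andP: (psi01 _ m2).
  rewrite sumr_const_nat -[leLHS]mulr_natr (exprSr _ 4) ler_wpM2l ?exprn_ge0// ler_nat.
  exact: leq_subr.
rewrite ger0_norm//.
have -> : 8 ^+ k.+1 * k.+1`!%:R * expR (3 / 8) * expR (cabs z ^+ 2 / 4) =
    8 ^+ k.+1 * k.+1`!%:R * expR ((2 * cabs z ^+ 2 + 3) / 8) :> R.
  by rewrite -[LHS]mulrA -expRD; congr (_ * expR _); field.
apply: le_trans (le_expr_expR k _); last by rewrite addr_ge0// mulr_ge0// sqr_ge0.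
rewrite k10 (exprM _ 5 2) lerXn2r// ?nnegrE ?exprn_ge0 ?addr_ge0 ?mulr_ge0 ?sqr_ge0//.
apply: (le_trans gN); rewrite lerXn2r ?nnegrE//.
by rewrite addr_ge0// mulr_ge0// sqr_ge0.
Qed.

(** * Finiteness of the Gaussian averages *)

Lemma measurable_annuli_symbol (R : realType) (psi : nat -> R[i] -> R) :
  (forall n, (2 <= n)%N -> forall z, psi n z != 0 -> annulus n z) ->
  (forall n, (2 <= n)%N ->
    measurable_fun [set: plane R]
      (psi n \o @cplx R : plane R -> R)) ->
  measurable_fun [set: plane R]
    (annuli_symbol psi \o @cplx R : plane R -> R).
Proof.
move=> supp mpsi.
apply: (@measurable_fun_cvg _ _ _ _
  (fun N p => \sum_(2 <= n < N) d_ R n * psi n (cplx p))).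
- move=> N; under eq_fun do rewrite -[2%N]add0n big_addn.
  apply: measurable_sum => n; apply: measurable_funM => //.
  by apply: mpsi; rewrite leq_addl.
- by move=> p _; apply: annuli_symbol_cvg => n n2; exact: supp.
Qed.

Lemma measurable_gauss_weight (R : realType) (a : R[i]) (f : R[i] -> R) :
  measurable_fun [set: plane R]
    (f \o @cplx R : plane R -> R) ->
  measurable_fun [set: plane R]
    (fun p => (expR (- cabs (cplx p - a) ^+ 2) * `|f (cplx p)| ^+ 2)%:E).
Proof.
move=> mf; apply/measurable_EFinP; apply: measurable_funM.
- apply: measurableT_comp => //; apply: measurableT_comp => //.
  by apply: measurable_funX; exact: measurable_cabsB.
- by apply: measurable_funX; exact: measurableT_comp.
Qed.

Lemma gauss_average_lty (R : realType) (g : R[i] -> R) (C : R) (a : R[i]) :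
  measurable_fun [set: plane R]
    (g \o @cplx R : plane R -> R) ->
  0 <= C -> (forall z, `|g z| ^+ 2 <= C * expR (cabs z ^+ 2 / 4)) ->
  (gauss_average g a < +oo)%E.
Proof.
move=> mg C0 gC; rewrite /gauss_average /planar_integral.
(* -|z - a|^2 + |z|^2 / 4 <= |a|^2 - |z|^2 / 4 *)
pose K := C * expR (cabs a ^+ 2).
pose G := (fun p : plane R =>
  (expR (- (cabs (cplx p) ^+ 2 / 4)))%:E).
have mG : measurable_fun setT G.
  apply/measurable_EFinP; apply: measurableT_comp => //.
  apply: measurableT_comp => //; apply: measurable_funM => //.
  by apply: measurable_funX; exact: measurable_cabs.
have K0 : 0 <= K by rewrite mulr_ge0// expR_ge0.
apply: (@le_lt_trans _ _ (\int[planar_lebesgue R]_p (K%:E * G p))%E).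
  apply: ge0_le_integral => //.
  - exact: measurable_gauss_weight.
  - exact: measurable_funeM.
  move=> p _; rewrite /G -EFinM lee_fin.
  apply: (@le_trans _ _ (expR (- cabs (cplx p - a) ^+ 2)
     * (C * expR (cabs (cplx p) ^+ 2 / 4)))).
    by rewrite ler_wpM2l ?expR_ge0.
  rewrite [leLHS]mulrCA -expRD /K -[leRHS]mulrA -expRD ler_wpM2l// ler_expR.
  have h := le_cabsD (cplx p - a) a; rewrite subrK in h.
  move: (cabs_ge0 (cplx p)) (cabs_ge0 (cplx p - a)) (cabs_ge0 a) h.
  move: (cabs (cplx p)) (cabs (cplx p - a)) (cabs a) => x y z x0 y0 z0 h.
  have : x ^+ 2 <= (y + z) ^+ 2 by rewrite lerXn2r// nnegrE addr_ge0.
  by have := sqr_ge0 (y - z); lra.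
rewrite ge0_integralZl//; last by move=> p _; rewrite lee_fin expR_ge0.
apply: lte_mul_pinfty => //; exact: gauss_plane_lty.
Qed.

(** * Area of the annuli *)

(** Over an abscissa x in [0, a / 2], the part of the annulus of radii a - r and
   a + r that lies in the upper half-plane contains a vertical segment of length at
   least 2 r: the difference of the two square roots is 4 a r divided by their sum,
   which is at most 2 a. *)
Lemma sqrt_subr_sqr_gap (R : realType) (a r x : R) :
  0 < r -> 0 <= x -> x <= a / 2 -> r <= a / 2 ->
  2 * r <= Num.sqrt ((a + r) ^+ 2 - x ^+ 2) - Num.sqrt ((a - r) ^+ 2 - x ^+ 2).
Proof.
move=> r0 x0 xa ra.
have x2 : x ^+ 2 <= (a - r) ^+ 2 by rewrite lerXn2r ?nnegrE; lra.
have x2' : x ^+ 2 <= (a + r) ^+ 2 by rewrite lerXn2r ?nnegrE; lra.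
have s2 : Num.sqrt ((a + r) ^+ 2 - x ^+ 2) ^+ 2 = (a + r) ^+ 2 - x ^+ 2.
  by rewrite sqr_sqrtr// subr_ge0.
have t2 : Num.sqrt ((a - r) ^+ 2 - x ^+ 2) ^+ 2 = (a - r) ^+ 2 - x ^+ 2.
  by rewrite sqr_sqrtr// subr_ge0.
have s0 := sqrtr_ge0 ((a + r) ^+ 2 - x ^+ 2).
have t0 := sqrtr_ge0 ((a - r) ^+ 2 - x ^+ 2).
move: s2 t2 s0 t0; set s := Num.sqrt _; set t := Num.sqrt (_ - _) => s2 t2 s0 t0.
have sa : s <= a + r.
  by rewrite -(@ler_pXn2r _ 2)// ?nnegrE ?s2; have := sqr_ge0 x; lra.
have ta : t <= a - r.
  by rewrite -(@ler_pXn2r _ 2)// ?nnegrE ?t2; have := sqr_ge0 x; lra.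
have st : (s - t) * (s + t) = 4 * a * r by rewrite -subr_sqr s2 t2; ring.
have ts : t < s by rewrite -(@ltr_pXn2r _ 2)// ?nnegrE// s2 t2; nra.
rewrite -(@ler_pM2r _ (2 * a)); last lra.
apply: (@le_trans _ _ ((s - t) * (s + t))); first by rewrite st; lra.
by rewrite ler_wpM2l//; lra.
Qed.

Lemma area_annulus_ge (R : realType) n :
  rho_ R n <= a_ R n / 2 -> 0 < rho_ R n ->
  ((a_ R n * rho_ R n)%:E <= area (@annulus R n))%E.
Proof.
set a := a_ R n; set r := rho_ R n => ra r0.
have a0 : 0 < a by lra.
pose B : set (plane R) := @cplx R @^-1` @annulus R n.
have mB : measurable B by exact: measurable_annulus.
rewrite /area -/B /planar_lebesgue /= /product_measure1 /=.
(* the slices over [0, a / 2], of length at least 2 r, contribute a r *)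
have -> : (a * r)%:E = (\int[@lebesgue_measure R]_x
    ((2 * r)%:E * (\1_(`[0, a / 2] : set R) x)%:E))%E.
  rewrite ge0_integralZl//; last 2 first.
  - by apply/measurable_EFinP; exact: measurable_indic.
  - by rewrite lee_fin; lra.
  rewrite integral_indic// setIT/= lebesgue_measure_itv/= lte_fin divr_gt0//.
  by rewrite sube0 -EFinM; congr EFin; field.
apply: ge0_le_integral => //.
- by move=> x _; rewrite -EFinM lee_fin mulr_ge0//; lra.
- by apply: measurable_funeM; apply/measurable_EFinP.
- exact: (@measurable_fun_xsection _ _ _ _ _ (@lebesgue_measure R)).
move=> x _; rewrite indicE; have [|_] := boolP (x \in _); last by rewrite mule0.
rewrite inE /= in_itv/= => /andP[x0 xa]; rewrite mule1.
pose I := `[Num.sqrt ((a - r) ^+ 2 - x ^+ 2),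
                    Num.sqrt ((a + r) ^+ 2 - x ^+ 2)]%R.
have gap := @sqrt_subr_sqr_gap R a r x r0 x0 xa ra.
have LI : lebesgue_measure ([set` I] : set R) = (Num.sqrt ((a + r) ^+ 2 - x ^+ 2) -
    Num.sqrt ((a - r) ^+ 2 - x ^+ 2))%:E.
  rewrite lebesgue_measure_itv/= lte_fin ifT; first by rewrite EFinB.
  lra.
apply: (@le_trans _ _ (lebesgue_measure ([set` I] : set R))); first by rewrite LI lee_fin.
apply: le_measure; rewrite ?inE//.
- exact: measurable_xsection.
move=> y; rewrite /I /= in_itv/= => /andP[y1 y2]; rewrite /xsection /= inE.
rewrite /B /annulus /= -/a -/r /cabs/=.
have x2' : x ^+ 2 <= (a + r) ^+ 2 by rewrite lerXn2r ?nnegrE; lra.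
have x2 : x ^+ 2 <= (a - r) ^+ 2 by rewrite lerXn2r ?nnegrE; lra.
have y0 : 0 <= y by apply: le_trans y1; exact: sqrtr_ge0.
have : (a - r) ^+ 2 - x ^+ 2 <= y ^+ 2.
  by rewrite -[leLHS]sqr_sqrtr ?subr_ge0// lerXn2r ?nnegrE ?sqrtr_ge0.
have : y ^+ 2 <= (a + r) ^+ 2 - x ^+ 2.
  by rewrite -[leRHS]sqr_sqrtr ?subr_ge0// lerXn2r ?nnegrE ?sqrtr_ge0.
move=> h1 h2; rewrite ler_norml; apply/andP; split.
  rewrite lerBrDr -(@ger0_norm _ (- r + a)); last lra.
  by rewrite -sqrtr_sqr ler_sqrt ?addr_ge0 ?sqr_ge0//; lra.
rewrite lerBlDr -(@ger0_norm _ (r + a)); last lra.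
by rewrite -sqrtr_sqr ler_sqrt ?sqr_ge0//; lra.
Qed.

Lemma rho_le_half (R : realType) n : (2 <= n)%N -> rho_ R n <= a_ R n / 2.
Proof.
move=> n2; have n1 : 1 <= n%:R :> R by rewrite ler1n ltnW.
have n2R : 2 <= n%:R :> R by rewrite ler_nat.
apply: (@le_trans _ _ (n%:R^-1)).
  by rewrite /rho_ -[leRHS]powR_inv1 ?ler0n//; apply: ler_powR => //; lra.
apply: (@le_trans _ _ (2^-1)); first by rewrite lef_pV2// posrE; lra.
rewrite -[leLHS]mul1r ler_pM2r// /a_ -[leLHS]sqrtr1 ler_sqrt//; lra.
Qed.

Lemma a_rho (R : realType) n : (0 < n)%N -> a_ R n * rho_ R n = n%:R ^- 4.
Proof.
move=> n0; rewrite /a_ /rho_ -powR12_sqrt ?ler0n// -powRD; last first.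
  by rewrite pnatr_eq0 -lt0n n0 implybT.
by rewrite -powR_mulrn ?ler0n// -powRN; congr (_ `^ _); field.
Qed.

Lemma area_annulus_lty (R : realType) n : (2 <= n)%N ->
  (area (@annulus R n) < +oo)%E.
Proof.
move=> n2; pose K : R := a_ R n + 1.
pose I := `[- K, K].
have K0 : 0 <= K by rewrite addr_ge0// sqrtr_ge0.
apply: (@le_lt_trans _ _ (planar_lebesgue R (([set` I] : set R) `*` ([set` I] : set R)))).
  apply: le_measure; rewrite ?inE.
  - exact: measurable_annulus.
  - by apply: measurableX.
  move=> [x y] xy.
  have /ler_normlP[_ h] : `|cabs (cplx (x, y)) - a_ R n| <= rho_ R n := xy.
  have {}h : cabs (cplx (x, y)) <= K by have := @rho_le1 R n (ltnW n2); rewrite /K; lra.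
  have : cabs (cplx (x, y)) ^+ 2 <= K ^+ 2.
    by rewrite lerXn2r ?nnegrE ?cabs_ge0.
  rewrite cabs_sqr/= => xyK.
  rewrite /I /= !in_itv/= -!ler_norml -!sqrtr_sqr -(ger0_norm K0) -sqrtr_sqr.
  by split; rewrite ler_sqrt ?sqr_ge0//; have := sqr_ge0 x; have := sqr_ge0 y; lra.
have -> : planar_lebesgue R (([set` I] : set R) `*` ([set` I] : set R)) =
    (lebesgue_measure ([set` I] : set R) * lebesgue_measure ([set` I] : set R))%E.
  exact: product_measure1E.
rewrite lebesgue_measure_itv/=; case: ifP => _; last by rewrite mul0e.
by rewrite -EFinB -EFinM ltry.
Qed.

(** * Lower bounds for Gaussian averages *)

(** A form of the Cauchy-Schwarz inequality with constant 3/4 instead of 1, obtained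
   by integrating c f <= f^2 + c^2 / 4 over A. *)
Lemma integral_sqr_ge (R : realType) (f : R[i] -> R) (A : set R[i]) (c : R) :
  measurable_fun [set: plane R]
    (f \o @cplx R : plane R -> R) ->
  measurable (@cplx R @^-1` A : set (plane R)) ->
  (area A < +oo)%E -> (forall z, 0 <= f z) -> (forall z, f z != 0 -> A z) ->
  0 <= c -> (c%:E * area A <= planar_integral (fun z => (f z)%:E))%E ->
  ((3 / 4 * c ^+ 2)%:E * area A <= planar_integral (fun z => (f z ^+ 2)%:E))%E.
Proof.
move=> mf mA Aoo f0 fA c0 cA; rewrite /planar_integral.
pose B : set (plane R) := @cplx R @^-1` A.
have mf2 : measurable_fun [set: plane R]
    (fun p => (f (cplx p) ^+ 2)%:E).
  by apply/measurable_EFinP; exact: measurable_funX.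
have mB : measurable_fun [set: plane R]
    (fun p => ((c ^+ 2 / 4)%:E * (\1_B p)%:E)%E).
  by apply: measurable_funeM; apply/measurable_EFinP; exact: measurable_indic.
have mcf : measurable_fun [set: plane R]
    (fun p => (c%:E * (f (cplx p))%:E)%E).
  by apply: measurable_funeM; apply/measurable_EFinP.
have c4 : 0 <= c ^+ 2 / 4 by rewrite divr_ge0// sqr_ge0.
have B0 p : (0 <= (c ^+ 2 / 4)%:E * (\1_B p)%:E)%E.
  by rewrite -EFinM lee_fin mulr_ge0.
have key : (\int[planar_lebesgue R]_p (c%:E * (f (cplx p))%:E) <=
    \int[planar_lebesgue R]_p
      ((f (cplx p) ^+ 2)%:E + (c ^+ 2 / 4)%:E * (\1_B p)%:E))%E.
  apply: ge0_le_integral => //.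
  - by move=> p _; rewrite -EFinM lee_fin mulr_ge0.
  - exact: emeasurable_funD.
  move=> p _; rewrite -!EFinM -EFinD lee_fin indicE.
  have [->|fp] := eqVneq (f (cplx p)) 0.
    by rewrite mulr0 expr0n/= add0r mulr_ge0.
  have -> : p \in B by rewrite inE; exact: fA.
  by rewrite mulr1; have := sqr_ge0 (f (cplx p) - c / 2); lra.
have intB : (\int[planar_lebesgue R]_p ((c ^+ 2 / 4)%:E * (\1_B p)%:E) =
    (c ^+ 2 / 4)%:E * area A)%E.
  rewrite ge0_integralZl//; last by apply/measurable_EFinP; exact: measurable_indic.
  by rewrite integral_indic// setIT.
rewrite ge0_integralD// in key; last by move=> p _; rewrite lee_fin sqr_ge0.
rewrite intB ge0_integralZl// in key; last 2 first.
- by apply/measurable_EFinP.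
- by move=> p _; rewrite lee_fin.
have {}key := le_trans (lee_wpmul2l _ cA) key.
move: (key c0) Aoo => {}key Aoo.
have A0 : (0 <= area A)%E by exact: measure_ge0.
have Afin : area A \is a fin_num by rewrite ge0_fin_numE.
move: key; rewrite -(fineK Afin); set a := fine _.
case: (\int[planar_lebesgue R]_p (f (cplx p) ^+ 2)%:E)%E => [r| |]//=.
  rewrite -!EFinM -EFinD !lee_fin; lra.
by move=> _; rewrite leey.
Qed.

(** If every point of the support of h is at squared distance at most K from some
   point of s, then h^2 <= exp(K) sum_(c in s) exp(-|z - c|^2) |g(z)|^2. *)
Lemma integral_le_sum_gauss_average (R : realType) (h g : R[i] -> R)
    (s : seq R[i]) (K : R) :
  measurable_fun [set: plane R]
    (h \o @cplx R : plane R -> R) ->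
  measurable_fun [set: plane R]
    (g \o @cplx R : plane R -> R) ->
  (forall z, 0 <= h z <= `|g z|) ->
  (forall z, h z != 0 -> exists2 c, c \in s & cabs (z - c) ^+ 2 <= K) ->
  (planar_integral (fun z => (h z ^+ 2)%:E) <=
    \sum_(c <- s) (expR K)%:E * gauss_average g c)%E.
Proof.
move=> mh mg hg hs; rewrite /planar_integral /gauss_average /planar_integral.
have mF c : measurable_fun [set: plane R]
    (fun p => ((expR K)%:E *
       (expR (- cabs (cplx p - c) ^+ 2) * `|g (cplx p)| ^+ 2)%:E)%E).
  by apply: measurable_funeM; exact: measurable_gauss_weight.
have F0 c p : (0 <= (expR K)%:E *
       (expR (- cabs (cplx p - c) ^+ 2) * `|g (cplx p)| ^+ 2)%:E)%E.
  by rewrite -EFinM lee_fin !mulr_ge0 ?expR_ge0 ?sqr_ge0.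
under eq_bigr => c _.
  rewrite -ge0_integralZl//; last exact: measurable_gauss_weight.
  over.
rewrite -ge0_integral_sum//.
apply: ge0_le_integral => //.
- by move=> p _; rewrite lee_fin sqr_ge0.
- by apply/measurable_EFinP; exact: measurable_funX.
- exact: emeasurable_sum.
move=> p _; have [h0 hle] := andP (hg (cplx p)).
have [->|/hs[c cs cK]] := eqVneq (h (cplx p)) 0.
  by rewrite expr0n/=; apply: sume_ge0 => c _; exact: F0.
rewrite (big_rem c)//=; apply: (@le_trans _ _ ((expR K)%:E *
       (expR (- cabs (cplx p - c) ^+ 2) * `|g (cplx p)| ^+ 2)%:E)%E).
  rewrite -EFinM lee_fin mulrA -expRD -[leLHS]mul1r; apply: ler_pM => //.
  - exact: sqr_ge0.
  - by rewrite -expR0 ler_expR; lra.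
  - by rewrite lerXn2r// nnegrE.
by rewrite leeDl//; apply: sume_ge0 => c' _; exact: F0.
Qed.

(** Pigeonhole for a sum of at most N weighted terms. *)
Lemma exists_large_summand (R : realType) (T : eqType) (s : seq T)
    (F : T -> \bar R) (M N k : R) (x : \bar R) :
  0 <= M -> 0 <= k -> (size s)%:R <= N ->
  ((N * (k * M))%:E < x)%E -> (x <= \sum_(c <- s) k%:E * F c)%E ->
  exists2 c, c \in s & (M%:E <= F c)%E.
Proof.
move=> M0 k0 sN Mx xs; apply: contrapT => nex.
have sumM : (\sum_(c <- s) k%:E * F c <= \sum_(c <- s) (k * M)%:E)%E.
  rewrite big_seq [leRHS]big_seq; apply: lee_sum => c cs.
  rewrite EFinM lee_wpmul2l// leNgt; apply/negP => MF.
  by apply: nex; exists c => //; exact: ltW.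
have := lt_le_trans Mx (le_trans xs sumM).
rewrite sumEFin lte_fin big_const_seq count_predT iter_addr_0 -mulr_natl.
by apply/negP; rewrite -leNgt ler_wpM2r// mulr_ge0.
Qed.

(** The points with integer coordinates in the square [-K, K] x [-K, K]. *)
Definition grid (R : realType) (K : nat) : seq R[i] :=
  [seq Complex (i%:R - K%:R) (j%:R - K%:R) | i <- iota 0 (2 * K).+1,
                                             j <- iota 0 (2 * K).+1].

Lemma grid_approx (R : realType) (K : nat) (z : R[i]) : cabs z <= K%:R ->
  exists2 c, c \in grid R K & cabs (z - c) ^+ 2 <= 2.
Proof.
case: z => x y zK.
have : cabs (Complex x y) ^+ 2 <= K%:R ^+ 2.
  by rewrite lerXn2r// nnegrE ?cabs_ge0.
rewrite cabs_sqr/= => xyK.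
have coord (t : R) : t ^+ 2 <= K%:R ^+ 2 -> exists2 i, i \in iota 0 (2 * K).+1 &
    0 <= t - (i%:R - K%:R) <= 1.
  move=> tK; have : `|t| <= K%:R.
    by rewrite -(@ler_pXn2r _ 2)// ?nnegrE// real_normK ?num_real.
  rewrite ler_norml => /andP[t1 t2].
  have t0 : 0 <= t + K%:R by lra.
  have /andP[i1 i2] := truncn_itv t0.
  (* i - K is the integer part of t, shifted by K so as to use naturals *)
  exists (Num.truncn (t + K%:R)); last by lra.
  rewrite mem_iota add0n leq0n/= ltnS -(ler_nat R) natrM; lra.
have [i iK xi] := coord x ltac:(by have := sqr_ge0 y; lra).
have [j jK yj] := coord y ltac:(by have := sqr_ge0 x; lra).
exists (Complex (i%:R - K%:R) (j%:R - K%:R)).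
  by apply/allpairsP; exists (i, j).
rewrite cabs_sqr/=; nra.
Qed.

Lemma size_grid (R : realType) (K : nat) : size (grid R K) = ((2 * K).+1 ^ 2)%N.
Proof. by rewrite size_allpairs size_iota mulnn. Qed.

Lemma d_sqr (R : realType) n : d_ R n ^+ 2 = n%:R ^+ 5 * ln n%:R ^+ 2.
Proof.
rewrite /d_ exprMn; congr (_ * _).
by rewrite -!powR_mulrn ?powR_ge0// -powRrM; congr (_ `^ _); field.
Qed.

(** Some point near A_n has a Gaussian average of order at least (log n)^2.  The
   constant 70 leaves a strict margin: 49 / 70 < 3 / 4. *)
Lemma exists_heavy_center (R : realType) (psi : nat -> R[i] -> R) (c1 : R) n :
  0 < c1 -> (2 <= n)%N ->
  (forall n, (2 <= n)%N ->
    measurable_fun [set: plane R]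
      (psi n \o @cplx R : plane R -> R)) ->
  (forall n, (2 <= n)%N -> forall z, psi n z != 0 -> annulus n z) ->
  (forall n, (2 <= n)%N -> forall z, 0 <= psi n z <= 1) ->
  (c1%:E * area (@annulus R n) <= planar_integral (fun z => (psi n z)%:E))%E ->
  exists2 c, a_ R n - 3 <= cabs c &
    ((c1 ^+ 2 / (70 * expR 2) * ln n%:R ^+ 2)%:E <=
      gauss_average (annuli_symbol psi) c)%E.
Proof.
move=> c10 n2 mpsi supp psi01 mass.
have n0 : (0 < n)%N by apply: ltnW.
have n2R : 2 <= n%:R :> R by rewrite ler_nat.
have ln0 : 0 < ln (n%:R : R) by rewrite ln_gt0// ltr1n.
have rho1 := rho_le1 R n0.
set a := a_ R n in rho1 *.
have a2 : a ^+ 2 = n%:R by rewrite sqr_sqrtr.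
have a0 : 0 <= a by exact: sqrtr_ge0.
pose h z := d_ R n * psi n z.
have mh : measurable_fun [set: plane R]
    (h \o @cplx R : plane R -> R).
  by apply: measurable_funM => //; exact: mpsi.
have h_ge0 z : 0 <= h z by rewrite mulr_ge0 ?d_ge0//; case/andP: (psi01 n n2 z).
have h_supp z : h z != 0 -> annulus n z.
  by rewrite mulf_eq0 negb_or => /andP[_]; exact: supp.
pose K := (Num.truncn a).+3.
have [Ka aK] : K%:R <= a + 3 /\ a + 2 <= K%:R.
  have /andP[] := truncn_itv a0; rewrite /K -!natr1; lra.
pose s := [seq c <- grid R K | a - 3 <= cabs c].
have near_s z : h z != 0 -> exists2 c, c \in s & cabs (z - c) ^+ 2 <= 2.
  move=> /h_supp /ler_normlP[]; rewrite -/a => z1 z2.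
  have [|c cK zc] := @grid_approx R K z; first by lra.
  exists c => //; rewrite mem_filter cK andbT.
  have zc2 : cabs (z - c) <= 2.
    by rewrite -(@ler_pXn2r _ 2)// ?nnegrE ?cabs_ge0//; lra.
  have := le_cabsD (z - c) c; rewrite subrK; lra.
have hg z : 0 <= h z <= `|annuli_symbol psi z|.
  rewrite h_ge0/=; apply: le_trans (ler_norm _).
  by apply: annuli_symbol_ge => // m m2; [exact: supp|exact: psi01].
have upper := @integral_le_sum_gauss_average R h (annuli_symbol psi) s 2
  mh (measurable_annuli_symbol supp mpsi) hg near_s.
have size_s : (size s)%:R <= 49 * n%:R :> R.
  apply: (@le_trans _ _ (size (grid R K))%:R).
    by rewrite ler_nat size_filter count_size.
  rewrite size_grid natrX -natr1 natrM.
  (* 2 K + 1 <= 2 a + 7 <= 7 a, as a >= sqrt 2 >= 7 / 5 *)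
  apply: (@le_trans _ _ ((7 * a) ^+ 2)); last by rewrite exprMn a2; lra.
  have a75 : 7 / 5 <= a by rewrite -(@ler_pXn2r _ 2)// ?nnegrE ?a2; lra.
  rewrite lerXn2r ?nnegrE//; lra.
set M := c1 ^+ 2 / (70 * expR 2) * ln n%:R ^+ 2.
have e2 : 0 < expR 2 :> R by exact: expR_gt0.
have M0 : 0 <= M by rewrite mulr_ge0 ?divr_ge0 ?mulr_ge0 ?sqr_ge0// ltW.
have lower : (((3 / 4) * c1 ^+ 2 * n%:R * ln n%:R ^+ 2)%:E <=
    planar_integral (fun z => (h z ^+ 2)%:E))%E.
  apply: (@le_trans _ _ ((3 / 4 * (d_ R n * c1) ^+ 2)%:E * area (@annulus R n))%E).
    apply: (@le_trans _ _
        ((3 / 4 * (d_ R n * c1) ^+ 2)%:E * (n%:R ^- 4)%:E)%E).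
      rewrite -EFinM lee_fin exprMn d_sqr le_eqVlt; apply/orP; left; apply/eqP.
      by field; rewrite pnatr_eq0 -lt0n.
    apply: lee_wpmul2l; first by rewrite lee_fin mulr_ge0// sqr_ge0.
    by rewrite -a_rho//; apply: area_annulus_ge; [exact: rho_le_half|exact: rho_gt0].
  apply: integral_sqr_ge => //.
  - exact: measurable_annulus.
  - exact: area_annulus_lty.
  - by rewrite mulr_ge0 ?d_ge0// ltW.
  have -> : planar_integral (fun z => (h z)%:E) =
      ((d_ R n)%:E * planar_integral (fun z => (psi n z)%:E))%E.
    rewrite /planar_integral -ge0_integralZl ?lee_fin ?d_ge0//.
    - by apply/measurable_EFinP; exact: mpsi.
    - by move=> p _; rewrite lee_fin; case/andP: (psi01 n n2 (cplx p)).
  by rewrite EFinM -muleA lee_wpmul2l// lee_fin d_ge0.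
have [|c cs Mc] := exists_large_summand M0 (ltW e2) size_s _ upper.
  apply: lt_le_trans lower; rewrite lte_fin.
  have -> : 49 * n%:R * (expR 2 * M) = 7 / 10 * c1 ^+ 2 * n%:R * ln n%:R ^+ 2 :> R.
    by rewrite /M; field; rewrite gt_eqF.
  have : 0 < c1 ^+ 2 * n%:R * ln n%:R ^+ 2 :> R.
    by rewrite !mulr_gt0 ?exprn_gt0// ltr0n.
  lra.
by exists c => //; move: cs; rewrite mem_filter => /andP[].
Qed.

(** * Divergence *)

Lemma cvg_sqrtB_pinfty (R : realType) (k : R) : (a_ R n - k @[n --> \oo] --> +oo).
Proof.
apply/cvgryPge => A; near=> n.
have An : (Num.max 0 (A + k)) ^+ 2 <= n%:R.
  apply: ltW; apply: (lt_le_trans (truncnS_gt _)); rewrite ler_nat.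
  by near: n; exact: nbhs_infty_ge.
rewrite lerBrDr; apply: (@le_trans _ _ (Num.max 0 (A + k))).
  by rewrite le_max lexx orbT.
by rewrite -(@ler_pXn2r _ 2)// ?nnegrE ?le_max ?lexx ?sqrtr_ge0// sqr_sqrtr.
Unshelve. all: by end_near. Qed.

Lemma cvg_ln_sqr_pinfty (R : realType) (k : R) : 0 < k ->
  k * ln n%:R ^+ 2 @[n --> \oo] --> +oo.
Proof.
move=> k0; apply/cvgryPge => A; near=> n.
pose B := Num.max 1 (A / k).
have [B1 BA] : 1 <= B /\ A / k <= B by rewrite !le_max !lexx orbT.
have Bn : expR B <= n%:R.
  apply: ltW; apply: (lt_le_trans (truncnS_gt _)); rewrite ler_nat.
  by near: n; exact: nbhs_infty_ge.
have Bln : B <= ln n%:R.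
  by rewrite -ler_expR lnK// posrE (lt_le_trans (expR_gt0 B)).
rewrite mulrC -ler_pdivrMr// (le_trans BA)// (le_trans Bln)//.
by rewrite expr2 ler_peMr//; lra.
Unshelve. all: by end_near. Qed.

Theorem corollary1p2 (R : realType) (psi : nat -> R[i] -> R) (c1 : R)
  (c1_gt0 : 0 < c1)
  (psi_Cc : forall n, (2 <= n)%N -> Cc_infty (psi n))
  (psi_radial : forall n, (2 <= n)%N -> radial (psi n))
  (psi_supp : forall n, (2 <= n)%N ->
     tsupport (psi n) `<=` @cplx R @^-1` @annulus R n)
  (psi_01 : forall n, (2 <= n)%N -> forall z, 0 <= psi n z <= 1)
  (psi_mass : forall n, (2 <= n)%N ->
     (c1%:E * area (@annulus R n)
        <= planar_integral (fun z => (psi n z)%:E))%E) :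
  [/\ forall a : R[i], (gauss_average (annuli_symbol psi) a < +oo)%E,
      ereal_sup (range (gauss_average (annuli_symbol psi))) = +oo%E
    & exists b : nat -> R[i],
        (cabs (b n) @[n --> \oo] --> +oo) /\
        (gauss_average (annuli_symbol psi) (b n) @[n --> \oo] --> +oo%E)].
Proof.
have supp n : (2 <= n)%N -> forall z, psi n z != 0 -> annulus n z.
  by move=> n2 [x y] nz; apply: (psi_supp n n2 (x, y)); exact: subset_closure.
have mpsi n : (2 <= n)%N ->
    measurable_fun [set: plane R]
      (psi n \o @cplx R : plane R -> R).
  move=> n2; apply: measurable_radial; last exact: psi_radial.
  by have [/(_ [::])[]] := psi_Cc n n2.
have /choice[b bP] : forall n, exists c, (2 <= n)%N -> a_ R n - 3 <= cabs c /\
    ((c1 ^+ 2 / (70 * expR 2) * ln n%:R ^+ 2)%:E <=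
      gauss_average (annuli_symbol psi) c)%E.
  move=> n.
  have [n2|] := boolP (2 <= n)%N; last by exists 0.
  have [c] := exists_heavy_center c1_gt0 n2 mpsi supp psi_01 (psi_mass n n2).
  by exists c.
have b_cvg : gauss_average (annuli_symbol psi) (b n) @[n --> \oo] --> +oo%E.
  apply/cvgeyPge => A; near=> n.
  have n2 : (2 <= n)%N by near: n; exact: nbhs_infty_ge.
  apply: le_trans (bP n n2).2; rewrite lee_fin; near: n.
  apply: cvgry_ge; apply: cvg_ln_sqr_pinfty.
  by rewrite divr_gt0 ?exprn_gt0// mulr_gt0// expR_gt0.
split.
- move=> a; have [C [C0 growth]] := annuli_symbol_growth R.
  apply: (gauss_average_lty (C := C)) => //.
    exact: measurable_annuli_symbol.
  by move=> z; apply: growth => n n2; [exact: supp|exact: psi_01].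
- apply: eq_infty => A.
  have /cvgeyPge/(_ A)[N _ /(_ N (leqnn N))/= AN] := b_cvg.
  by apply: le_trans AN _; apply: ereal_sup_ubound; exists (b N).
- exists b; split => //.
  apply/cvgryPge => A; near=> n.
  have n2 : (2 <= n)%N by near: n; exact: nbhs_infty_ge.
  apply: le_trans (bP n n2).1; near: n.
  by apply: cvgry_ge; exact: cvg_sqrtB_pinfty.
Unshelve. all: by end_near. Qed.
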